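(* Let $\Gamma$ be a group generated by a finite symmetric set $S=S^{-1}\subset\Gamma$, with growth function $\gamma_S$. Then: (1) For every non-empty finite subset $D\subset\Gamma$, $$\frac{|\partial_S D|}{|D|}\ \ge\ \mathcal{U}_{\gamma_S}(|D|).$$ (2) For every integer $n\ge 1$ with $\text{Føl}(n)<\infty$, $$\mathcal{U}_{\gamma_S}(\text{Føl}(n))\ \le\ \frac1n .$$ (3) If $\Gamma$ is finite and non-trivial, then its Cheeger constant satisfies $$h_S(\Gamma)\ \ge\ \mathcal{U}_{\gamma_S}\left(\tfrac12|\Gamma|\right).$$
   Context: For an integer $r\ge 0$, $B_S(r)\subset\Gamma$ is the set of elements that can be written as a product of at most $r$ elements of $S$ (so $B_S(0)=\{e\}$). The growth function is $\gamma_S(r)=|B_S(r)|$. The right-invariant word metric is $d_S(x,y)=\min\{r\ge 0 : xy^{-1}\in B_S(r)\}$. The (inner) boundary of $D\subset\Gamma$ is $\partial_S D=\{x\in D : \exists s\in S,\ sx\notin D\}$. The edge boundary is $E_S(D)=\{\{x,y\} : x\in D,\ y\in\Gamma\setminus D,\ d_S(x,y)=1\}$. The $\mathcal{U}$-transform of $\gamma_S$ is, for real $t\ge 0$, $$\mathcal{U}_{\gamma_S}(t)=\sup\left\{\frac1r\left(1-\frac{t}{\gamma_S(r)}\right) : r\in\{1,2,3,\dots\}\right\}.$$ The Følner function of $(\Gamma,S)$ is, for integers $n\ge 1$, $$\text{Føl}(n)=\min\{k\ge 1 : \exists D\subset\Gamma \text{ with } |D|=k \text{ and } k\ge n|\partial_S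 D|\},$$ with $\min\emptyset=+\infty$. For a finite group $\Gamma$, the Cheeger constant is $h_S(\Gamma)=\min\left\{\frac{|E_S(D)|}{|D|} : D\subset\Gamma,\ 0<|D|\le\frac12|\Gamma|\right\}$. *)

(* Defs.v *)
From mathcomp Require Import all_boot all_order all_algebra finmap.
From mathcomp Require Import mathcomp_extra boolp classical_sets functions.
From mathcomp Require Import cardinality reals.

Set Implicit Arguments.
Unset Strict Implicit.
Unset Printing Implicit Defensive.

Import Order.TTheory GRing.Theory Num.Theory.
Local Open Scope classical_set_scope.
Local Open Scope ring_scope.

(* [None] stands for the value [+oo] of the minimum of the empty set. *)
Definition nat_min (P : nat -> Prop) : option nat :=
  if pselect (exists k, `[< P k >]) is left exP then Some (ex_minn exP)
  else None.

Definition symmetric_fset (G : groupType) (S : {fset G}) : Prop :=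
  [fset (s^-1)%g | s in S]%fset = S.

Definition generates (G : groupType) (S : {fset G}) : Prop :=
  forall H : {pred G}, group_closed H -> {subset S <= H} ->
  forall x : G, x \in H.

Definition word_ball (G : groupType) (S : {fset G}) (r : nat) : set G :=
  [set x | exists w : seq G,
     [/\ (size w <= r)%N, {subset w <= S} & x = (\prod_(s <- w) s)%g]].

(* [fset_set] is [fset0] on infinite sets; balls are finite because [S] is. *)
Definition growth (G : groupType) (S : {fset G}) (r : nat) : nat :=
  #|` fset_set (word_ball S r)|.

Definition word_dist (G : groupType) (S : {fset G}) (x y : G) : option nat :=
  nat_min (fun r => word_ball S r (x / y)%g).

Definition inner_boundary (G : groupType) (S D : {fset G}) : {fset G} :=
  [fset x in D | [exists s : S, (val s * x)%g \notin D]]%fset.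

(* The edge {x, y} is the two-element set [fset x; y]: edges are unoriented. *)
Definition edge_boundary (G : groupType) (S D : {fset G}) : set {fset G} :=
  [set e | exists x y : G, [/\ x \in D, y \notin D,
     word_dist S x y = Some 1%N & e = [fset x; y]%fset]].

(* For [t >= 0] the set is non-empty and bounded above by 1, so that [sup] is
   a genuine supremum. *)
Definition U_transform (R : realType) (gamma : nat -> nat) (t : R) : R :=
  sup [set r%:R^-1 * (1 - t / (gamma r)%:R) | r in [set r | (1 <= r)%N]].

Definition Folner (G : groupType) (S : {fset G}) (n : nat) : option nat :=
  nat_min (fun k => (1 <= k)%N /\ exists D : {fset G},
    #|` D| = k /\ (n * #|` inner_boundary S D| <= k)%N).

Definition group_card (G : groupType) : nat := #|` fset_set [set: G]|.

(* Meant for a finite non-trivial group: the set is then finite and non-empty,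
   so that the infimum is a minimum; the edge boundary is finite because [D]
   and [S] are. *)
Definition cheeger (R : realType) (G : groupType) (S : {fset G}) : R :=
  inf [set #|` fset_set (edge_boundary S D)|%:R / #|` D|%:R
      | D in [set D : {fset G} | (0 < #|` D|)%N /\
                #|` D|%:R <= 2^-1 * (group_card G)%:R :> R]].

(* Main.v *)
(* If g is a product of at most r generators and x lies in D but g x does not,
   then the walk from x to g x along the letters of g crosses the boundary of
   D; hence at most r |∂D| points of D are moved out of D by g. On the other
   hand each x in D is moved out of D by all but at most |D| elements g of the
   ball of radius r. Double counting gives
   |D| (γ(r) - |D|) <= γ(r) r |∂D|, which is the first claim. The Følner bound
   is the case of an optimal set, and the Cheeger bound follows from
   |E(D)| >= |∂D|: picking for each boundary point one edge that leaves D is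
   injective, since D contains only one endpoint of such an edge. *)
Require Import Defs.
From mathcomp Require Import all_boot all_order all_algebra finmap.
From mathcomp Require Import mathcomp_extra boolp classical_sets functions.
From mathcomp Require Import cardinality reals.
From mathcomp Require Import ring.

Set Implicit Arguments.
Unset Strict Implicit.
Unset Printing Implicit Defensive.

Import Order.TTheory GRing.Theory Num.Theory.
Local Open Scope classical_set_scope.
Local Open Scope ring_scope.

Lemma leq_card_inj_fset (T U : choiceType) (f : T -> U) (A : {fset T})
    (B : {fset U}) :
  {in A &, injective f} -> (forall x, x \in A -> f x \in B) ->
  (#|` A| <= #|` B|)%N.
Proof.
move=> f_inj fAB; rewrite -(card_in_imfset imfset_key f_inj).
by apply/fsubset_leq_card/fsubsetP => _ /imfsetP[x xA ->]; apply: fAB.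
Qed.

Lemma card_fset_cond_sum (T : choiceType) (A : {fset T}) (P : pred T) :
  #|` [fset x in A | P x]%fset| = (\sum_(x <- A) P x)%N.
Proof. by rewrite card_fset_sum1 -big_fset_condE -big_mkcond. Qed.

Lemma inner_boundaryP (G : groupType) (S D : {fset G}) (x : G) :
  reflect (x \in D /\ exists2 s, s \in S & (s * x)%g \notin D)
          (x \in inner_boundary S D).
Proof.
rewrite !inE; apply: (iffP andP) => [[xD /existsP[s sxD]]|[xD [s sS sxD]]].
  by split=> //; exists (val s) => //; apply: valP.
by split=> //; apply/existsP; exists [` sS]%fset.
Qed.

(* The last point of the walk [x, s_k x, s_(k-1) s_k x, ...] before it leaves
   [D] lies on the boundary, and [x] is determined by it and by its time. *)
Lemma card_exit_prod (G : groupType) (S D : {fset G}) (w : seq G) :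
  {subset w <= S} ->
  (#|` [fset x in D | ((\prod_(s <- w) s)%g * x)%g \notin D]%fset|
     <= size w * #|` inner_boundary S D|)%N.
Proof.
elim: w => [|s w IHw] wS.
  rewrite big_nil leqn0 cardfs_eq0; apply/eqP/fsetP => x.
  by rewrite !inE mul1g andbN.
have {}IHw := IHw (fun t tw => wS t (mem_behead (s := s :: w) tw)).
rewrite big_cons; set g := (\prod_(t <- w) t)%g in IHw *.
(* [A] holds the points that leave [D] only at the last letter [s]: [x] goes to [g * x],
   injectively, inside the boundary. The points of [B] fall to the induction hypothesis. *)
pose A := [fset x in D | (g * x \in D) && (s * (g * x) \notin D)]%g%fset.
pose B := [fset x in D | (g * x)%g \notin D]%fset.
have sAB : ([fset x in D | (s * g * x)%g \notin D] `<=` A `|` B)%fset.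
  apply/fsubsetP => x; rewrite !inE -mulgA => /andP[-> ->] /=.
  by rewrite andbT orbN.
apply: leq_trans (fsubset_leq_card sAB) _.
apply: leq_trans (leq_card_fsetU A B).1 _.
rewrite /= mulSn leq_add // (leq_card_inj_fset (f := fun x => (g * x)%g)) //.
  by move=> x y _ _; apply: mulgI.
move=> x xA; rewrite !inE in xA; case/and3P: xA => _ gxD sgxD.
apply/inner_boundaryP; split=> //; exists s => //.
by apply: wS; rewrite mem_head.
Qed.

(** Keeps [growth] off the default value of [fset_set]. A non-empty word is a letter followed by a
    shorter word. *)
Lemma finite_word_ball (G : groupType) (S : {fset G}) (r : nat) :
  finite_set (word_ball S r).
Proof.
elim: r => [|r IHr].
  apply: (sub_finite_set _ (finite_set1 1%g)) => x [w [w0 _ ->]].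
  by move: w0; rewrite leqn0 => /nilP ->; rewrite big_nil.
apply: (@sub_finite_set _ _ ([set 1%g] `|`
    [set (s * g)%g | s in [set` S] & g in word_ball S r])).
  move=> x [[|s w] [/= wr wS ->]]; first by left; rewrite big_nil.
  right; rewrite big_cons; exists s; first by apply: wS; rewrite mem_head.
  exists (\prod_(t <- w) t)%g => //; exists w; split=> // t tw.
  by apply: wS; rewrite inE tw orbT.
by rewrite finite_setU; split=> //; apply: finite_image2.
Qed.

Lemma word_ball1 (G : groupType) (S : {fset G}) (r : nat) :
  word_ball S r 1%g.
Proof. by exists [::]; rewrite big_nil. Qed.

Lemma growth_gt0 (G : groupType) (S : {fset G}) (r : nat) :
  (0 < growth S r)%N.
Proof.
rewrite cardfs_gt0; apply/fset0Pn; exists 1%g.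
by rewrite in_fset_set ?inE; [apply: word_ball1 | apply: finite_word_ball].
Qed.

(* Double counting of the pairs [(g, x)] with [g] in the ball, [x] in [D] and
   [g x] outside [D]. *)
Lemma card_inner_boundary_ge (G : groupType) (S D : {fset G}) (r : nat) :
  (#|` D| * (growth S r - #|` D|)
     <= growth S r * (r * #|` inner_boundary S D|))%N.
Proof.
set B := fset_set (word_ball S r).
have le_exit g : g \in B ->
    (\sum_(x <- D) ((g * x)%g \notin D) <= r * #|` inner_boundary S D|)%N.
  rewrite in_fset_set ?inE; last exact: finite_word_ball.
  case=> w [wr wS ->]; rewrite -card_fset_cond_sum.
  by apply: leq_trans (card_exit_prod D wS) _; rewrite leq_mul2r wr orbT.
have ge_exit x :
    (growth S r - #|` D| <= \sum_(g <- B) ((g * x)%g \notin D))%N.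
  rewrite leq_subLR /growth -/B.
  have -> : #|` B| = (\sum_(g <- B) ((g * x)%g \in D)
                      + \sum_(g <- B) ((g * x)%g \notin D))%N.
    by rewrite card_fset_sum1 -big_split; apply: eq_bigr => g _; case: (_ \in D).
  rewrite leq_add2r -card_fset_cond_sum.
  apply: (leq_card_inj_fset (f := fun g => (g * x)%g)).
    by move=> g h _ _; apply: mulIg.
  by move=> g; rewrite !inE => /andP[].
rewrite {1}card_fset_sum1 big_distrl /= /growth [X in (_ <= X * _)%N]card_fset_sum1.
rewrite big_distrl /=.
apply: (@leq_trans (\sum_(x <- D) \sum_(g <- B) ((g * x)%g \notin D))).
  by apply: leq_sum => x _; rewrite mul1n.
rewrite exchange_big /= big_seq [X in (_ <= X)%N]big_seq.
by apply: leq_sum => g gB; rewrite mul1n le_exit.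
Qed.

Lemma U_transform_le (R : realType) (gamma : nat -> nat) (t c : R) :
  (forall r, (0 < r)%N -> r%:R^-1 * (1 - t / (gamma r)%:R) <= c) ->
  U_transform gamma t <= c.
Proof.
move=> le_c; apply: ge_sup => [|_ [r r_gt0 <-]]; last exact: le_c.
(* The index 1 witnesses the non-emptiness required by [ge_sup]. *)
by exists (1%:R^-1 * (1 - t / (gamma 1)%:R)), 1%N.
Qed.

(* The real number [t] is decoupled from [#|` D|] for the sake of the Cheeger
   constant, where [t] is half the order of the group. *)
Lemma U_transform_growth_le (R : realType) (G : groupType) (S D : {fset G})
    (t : R) :
  D != fset0 -> #|` D|%:R <= t ->
  U_transform (growth S) t <= #|` inner_boundary S D|%:R / #|` D|%:R.
Proof.
move=> D_neq0 le_Dt; apply: U_transform_le => r r_gt0.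
have D_gt0 : 0 < #|` D|%:R :> R by rewrite ltr0n cardfs_gt0.
have gr_gt0 : 0 < (growth S r)%:R :> R by rewrite ltr0n growth_gt0.
have r_pos : 0 < r%:R :> R by rewrite ltr0n.
(* Each term of the transform decreases in [t], so [t] may be lowered to the cardinal of [D]. *)
apply: (@le_trans _ _ (r%:R^-1 * (1 - #|` D|%:R / (growth S r)%:R))).
  by rewrite ler_pM2l ?invr_gt0 // lerB // ler_pM2r ?invr_gt0.
have key : #|` D|%:R * ((growth S r)%:R - #|` D|%:R)
    <= (growth S r)%:R * (r%:R * #|` inner_boundary S D|%:R) :> R.
  (* Subtraction in [nat] truncates at 0, so it dominates the real difference, which is negative for
     small balls. *)
  rewrite -!natrM; apply: (@le_trans _ _ (#|` D| * (growth S r - #|` D|))%N%:R).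
    by rewrite natrM ler_pM2l // lerBlDr -natrD ler_nat addnC -leq_subLR.
  by rewrite ler_nat card_inner_boundary_ge.
rewrite ler_pdivlMr // -(ler_pM2l (mulr_gt0 gr_gt0 r_pos)) -[leRHS]mulrA.
apply: le_trans key; rewrite le_eqVlt; apply/orP; left; apply/eqP; field.
by rewrite !gt_eqF.
Qed.

Lemma nat_minP (P : nat -> Prop) (k : nat) :
  nat_min P = Some k <-> P k /\ forall m, P m -> (k <= m)%N.
Proof.
rewrite /nat_min; case: pselect => [exP|nexP]; last first.
  by split=> // -[Pk _]; case: nexP; exists k; apply/asboolP.
case: ex_minnP => m /asboolP Pm min_m; split=> [[<-]|[Pk min_k]].
  by split=> // j Pj; apply/min_m/asboolP.
by congr Some; apply/eqP; rewrite eqn_leq min_k // andbT; apply/min_m/asboolP.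
Qed.

(** Distance 0 means [x = y]; this case must be excluded because [S] may contain the identity. *)
Lemma word_dist_eq1 (G : groupType) (S : {fset G}) (x y : G) :
  x != y -> (word_dist S x y = Some 1%N <-> (x / y)%g \in S).
Proof.
move=> x_neq_y; have not_ball0 : ~ word_ball S 0 (x / y)%g.
  move=> [w []]; rewrite leqn0 => /nilP -> _; rewrite big_nil => xy1.
  by move: x_neq_y; rewrite -(divgK y x) xy1 mul1g eqxx.
rewrite nat_minP; split=> [[[w [w1 wS xy]] _]|xyS].
  case: w w1 wS xy => [|s [|//]] _ wS xy.
    by case: not_ball0; exists [::].
  by rewrite xy big_seq1 wS ?mem_head.
split; last by case.
exists [:: (x / y)%g]; rewrite big_seq1; split=> // z.
by rewrite inE => /eqP ->.
Qed.

(** An edge is determined by its endpoint [x] in [D] and the letter [s = x / y], since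
    [y = s^-1 * x]. *)
Lemma finite_edge_boundary (G : groupType) (S D : {fset G}) :
  finite_set (edge_boundary S D).
Proof.
apply: (@sub_finite_set _ _ [set [fset x; (s^-1 * x)%g]%fset |
    x in [set` D] & s in [set` S]]); last exact: finite_image2.
move=> _ [x [y [xD yD xy1 ->]]]; exists x => //; exists (x / y)%g.
  have xy : x != y by apply: contraNneq yD => <-.
  exact/word_dist_eq1.
by rewrite invgM invgK divgK.
Qed.

Lemma symmetric_fsetV (G : groupType) (S : {fset G}) (s : G) :
  symmetric_fset S -> s \in S -> (s^-1)%g \in S.
Proof. by move=> S_sym sS; rewrite -S_sym; apply: in_imfset. Qed.

Lemma leq_card_edge_boundary (G : groupType) (S D : {fset G}) :
  symmetric_fset S ->
  (#|` inner_boundary S D| <= #|` fset_set (edge_boundary S D)|)%N.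
Proof.
move=> S_sym.
have /choice[f fP] (x : G) : exists s : G,
    x \in inner_boundary S D -> s \in S /\ (s * x)%g \notin D.
  by case: inner_boundaryP => [[_ [s]]|_]; [exists s | exists 1%g].
pose edge x := [fset x; (f x * x)%g]%fset.
apply: (leq_card_inj_fset (f := edge)) => [x y xB yB exy|x xB].
  have [[xD _] [yD _]] := (inner_boundaryP _ _ _ xB, inner_boundaryP _ _ _ yB).
  have [_ fyD] := fP y yB.
  have : x \in edge y by rewrite -exy !inE eqxx.
  by rewrite !inE => /orP[/eqP //|/eqP xE]; rewrite -xE xD in fyD.
have [xD _] := inner_boundaryP _ _ _ xB; have [sS sxD] := fP x xB.
rewrite in_fset_set ?inE; last exact: finite_edge_boundary.
exists x, (f x * x)%g; split=> //; apply/word_dist_eq1.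
  by apply: contraNneq sxD => <-.
(* The quotient of [x] by [f x * x] is the inverse of [f x], which lies in [S] by symmetry. *)
by rewrite invgM mulgA mulgV mul1g symmetric_fsetV.
Qed.

Theorem theorem3p4 (R : realType) (G : groupType) (S : {fset G})
    (S_sym : symmetric_fset S) (S_gen : generates S) :
  [/\ forall D : {fset G}, D != fset0 ->
        #|` inner_boundary S D|%:R / #|` D|%:R
          >= U_transform (growth S) (#|` D|%:R : R),
      forall n k : nat, (1 <= n)%N -> Folner S n = Some k ->
        U_transform (growth S) (k%:R : R) <= 1 / n%:R
    & finite_set [set: G] -> (exists x : G, x != 1%g) ->
        cheeger R S >= U_transform (growth S) (2^-1 * (group_card G)%:R : R)].
Proof.
split=> [D D_neq0|n k n_gt0|G_fin [a a_neq1]].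
- exact: U_transform_growth_le.
- move=> /nat_minP[[k_gt0 [D [Dk le_nk]]] _].
  have D_neq0 : D != fset0 by rewrite -cardfs_gt0 Dk.
  rewrite -Dk; apply: le_trans (U_transform_growth_le S D_neq0 (lexx _)) _.
  rewrite ler_pdivrMr ?ltr0n ?Dk // mulrAC ler_pdivlMr ?ltr0n // mul1r.
  by rewrite -natrM ler_nat mulnC.
apply: lb_le_inf.
  (* The infimum needs an admissible set: a singleton has at most half the order of the group, as
     [1] and [a] are distinct. *)
  eexists; exists [fset 1%g]%fset => //=; rewrite cardfs1; split=> //.
  rewrite mulrC ler_pdivlMr ?ltr0n // mul1r ler_nat.
  apply: leq_trans (fsubset_leq_card (_ : [fset 1%g; a] `<=` _)%fset).
    by rewrite cardfs2 eq_sym a_neq1.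
  by apply/fsubsetP => x _; rewrite in_fset_set ?inE.
move=> _ [D [D_gt0 le_D] <-]; rewrite cardfs_gt0 in D_gt0.
apply: le_trans (U_transform_growth_le S D_gt0 le_D) _.
by rewrite ler_wpM2r ?invr_ge0 // ler_nat leq_card_edge_boundary.
Qed.
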